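(* Let $\ell, n$ be positive integers with $\ell \leq n$. (A) For every subgroup $H \leq S_n$, $\operatorname{gComp}^{(n)} \operatorname{gPat}^{(\ell)} H = \operatorname{Aut} \operatorname{pcInv} H$. (B) Let $H$ be a subgroup of $S_n$. Then the following are equivalent: (a) $H = \operatorname{gComp}^{(n)} \operatorname{gPat}^{(\ell)} H$; (a)$'$ there exists a subgroup $G \leq S_\ell$ such that $H = \operatorname{gComp}^{(n)} G$; (b) $H = \operatorname{Aut} \operatorname{pcInv} H$; (c) there exist $k \leq \ell$ and $\rho \subseteq [n]^k_{\neq}$ such that $\rho = (\rho^{\lor})^{\land}$ and $H = \operatorname{Aut} \rho$.
   Context: $[n] := \{1,\dots,n\}$; $\mathcal{P}_\ell(n)$ is the set of all $\ell$-element subsets of $[n]$; $A^k_{\neq}$ is the set of $k$-tuples over $A$ with pairwise distinct entries; $S_n$ is the symmetric group on $[n]$; $\langle T \rangle$ is the subgroup generated by $T$. Arities $k$ are positive integers. A map is applied to a tuple componentwise, and $\operatorname{Im}\mathbf{r}$ is the set of entries of the tuple $\mathbf{r}$. Patterns: for $I \in \mathcal{P}_\ell(n)$, $h_I \colon [\ell] \to I$ is the unique order-isomorphism. For $\pi \in S_n$, $\pi_I := h_{\pi(I)}^{-1} \circ \pi|_I \circ h_I \in S_\ell$, and $\operatorname{Pat}^{(\ell)} \pi := \{\pi_I \mid I \in \mathcal{P}_\ell(n)\}$. For subgroups $G \leq S_\ell$ and $H \leq S_n$, $$\operatorname{gComp}^{(n)} G := \{\tau \in S_n \mid \operatorname{Pat}^{(\ell)}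 \tau \subseteq G\}, \qquad \operatorname{gPat}^{(\ell)} H := \Bigl\langle \bigcup_{\tau \in H} \operatorname{Pat}^{(\ell)} \tau \Bigr\rangle \leq S_\ell$$ ($\operatorname{gComp}^{(n)} G$ is a subgroup of $S_n$). Relations: for $k \leq \ell$, $\rho \subseteq [n]^k$ and $\sigma \subseteq [\ell]^k$, define $$\rho^{\lor} := \{h_I^{-1}(\mathbf{r}) \mid \mathbf{r} \in \rho,\ \operatorname{Im}\mathbf{r} \subseteq I \in \mathcal{P}_\ell(n)\} \subseteq [\ell]^k, \qquad \sigma^{\land} := \{h_J(\mathbf{s}) \mid \mathbf{s} \in \sigma,\ J \in \mathcal{P}_\ell(n)\} \subseteq [n]^k .$$ A $k$-ary relation $\rho \subseteq [n]^k$ with $k \leq \ell$ is a pattern closed relation (pc-relation) if for all $\mathbf{r} \in [n]^k$ and all $I, J \in \mathcal{P}_\ell(n)$: if $\operatorname{Im}\mathbf{r} \subseteq I$ and $\mathbf{r} \in \rho$, then $h_J h_I^{-1}(\mathbf{r}) \in \rho$. A permutation $\pi \in S_n$ preserves $\rho \subseteq [n]^k$ if $\pi(\mathbf{r}) \in \rho$ for all $\mathbf{r} \in \rho$. $\operatorname{Aut} \rho$ is the set of $\pi \in S_n$ preserving $\rho$, and for a set $R$ of relations $\operatorname{Aut} R := \bigcap_{\rho \in R} \operatorname{Aut} \rho$. For $H \subseteq S_n$, $\operatorname{pcInv} H$ is the set of all pc-relations on $[n]$ (of arities $k \leq \ell$) preserved by every $\pi \in H$. *)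

(* Defs.v *)
From mathcomp Require Import all_boot all_fingroup.

Set Implicit Arguments.
Unset Strict Implicit.
Unset Printing Implicit Defensive.

(* [n] = {1,...,n} is rendered by the ordinals 'I_n = {0,...,n-1}. *)

Section OrderIsomorphism.
Variables l n : nat.

Definition lsubset := {I : {set 'I_n} | #|I| == l}.

(* The elements of I, as a type: a tuple r over [n] with Im r \subset I is
   (the image under val of) a tuple over [elt I]. *)
Definition elt (I : lsubset) := {x : 'I_n | x \in val I}.

Lemma card_lsubset (I : lsubset) : #|val I| = l.
Proof. exact/eqP/(valP I). Qed.

(* [enum (val I)] lists I in increasing order; see [h_mono]. *)
Definition h (I : lsubset) (i : 'I_l) : elt I :=
  exist _ (enum_val (cast_ord (esym (card_lsubset I)) i)) (enum_valP _).

Definition hinv (I : lsubset) (x : elt I) : 'I_l :=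
  cast_ord (card_lsubset I) (enum_rank_in (valP x) (val x)).

Lemma hK (I : lsubset) : cancel (@h I) (@hinv I).
Proof.
by move=> i; rewrite /hinv /= enum_valK_in; apply: val_inj.
Qed.

Lemma hinvK (I : lsubset) : cancel (@hinv I) (@h I).
Proof.
move=> x; apply: val_inj => /=.
by rewrite cast_ordK enum_rankK_in ?(valP x).
Qed.

Lemma h_mono (I : lsubset) (i j : 'I_l) :
  (val (h I i) < val (h I j)) = (i < j).
Proof.
have srt : sorted ltn (map val (enum (val I))).
  apply: (@subseq_sorted _ _ ltn_trans _ (map val (enum 'I_n))).
    by apply: map_subseq; rewrite [enum 'I_n]enumT; apply: filter_subseq.
  by rewrite val_enum_ord iota_ltn_sorted.
have hE k : val (val (h I k)) = nth 0 (map val (enum (val I))) k.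
  rewrite (nth_map (val (h I k))) -?cardE ?card_lsubset //=; congr val.
  exact: enum_val_nth.
have szh (k : 'I_l) : k < size (map val (enum (val I))).
  by rewrite size_map -cardE card_lsubset.
have homo_h (a b : 'I_l) : a < b -> val (val (h I a)) < val (val (h I b)).
  by rewrite !hE; apply: (sorted_ltn_nth ltn_trans 0 srt); rewrite ?inE ?szh.
case: (ltngtP i j) => [/homo_h // | /homo_h/ltnW | /val_inj ->].
  by rewrite leqNgt => /negbTE.
exact: ltnn.
Qed.

Lemma card_imlsubset (p : 'S_n) (I : lsubset) : #|p @: val I| == l.
Proof. by rewrite card_imset ?card_lsubset //; apply: perm_inj. Qed.

Definition imlsubset (p : 'S_n) (I : lsubset) : lsubset :=
  exist _ (p @: val I) (card_imlsubset p I).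

Definition restr (p : 'S_n) (I : lsubset) (x : elt I) : elt (imlsubset p I) :=
  exist _ (p (val x)) (imset_f p (valP x)).

Lemma patt_inj (p : 'S_n) (I : lsubset) :
  injective (@hinv (imlsubset p I) \o @restr p I \o @h I).
Proof.
move=> i j /(can_inj (@hinvK _)) /(congr1 val) /= /perm_inj eq_h.
by apply: (can_inj (@hK I)); apply: val_inj.
Qed.

Definition patt (p : 'S_n) (I : lsubset) : 'S_l := perm (@patt_inj p I).

Lemma h_patt (p : 'S_n) (I : lsubset) (i : 'I_l) :
  val (h (imlsubset p I) (patt p I i)) = p (val (h I i)).
Proof. by rewrite permE /comp hinvK. Qed.

Definition Pat (p : 'S_n) : {set 'S_l} := [set patt p I | I : lsubset].

End OrderIsomorphism.

Arguments Pat l {n} p.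

Definition gComp l n (G : {set 'S_l}) : {set 'S_n} :=
  [set t : 'S_n | Pat l t \subset G].
Arguments gComp {l} n G.

Definition gPat l n (H : {set 'S_n}) : {set 'S_l} :=
  (<< \bigcup_(t in H) Pat l t >>)%g.
Arguments gPat l {n} H.

Section Relations.
Variables l n k : nat.

Definition rel_down (rho : {set k.-tuple 'I_n}) : {set k.-tuple 'I_l} :=
  \bigcup_(I : lsubset l n)
    [set map_tuple (@hinv l n I) r | r : k.-tuple (elt I)
                                   & map_tuple val r \in rho].

Definition rel_up (sigma : {set k.-tuple 'I_l}) : {set k.-tuple 'I_n} :=
  [set map_tuple (fun i => val (h J i)) s
     | s : k.-tuple 'I_l in sigma, J : lsubset l n in setT].

Definition pc_relation (rho : {set k.-tuple 'I_n}) : bool :=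
  [forall I : lsubset l n, forall J : lsubset l n,
   forall r : k.-tuple (elt I),
     (map_tuple val r \in rho) ==>
     (map_tuple (fun x => val (h J (hinv x))) r \in rho)].

Definition preserves (p : 'S_n) (rho : {set k.-tuple 'I_n}) : bool :=
  [forall r in rho, map_tuple p r \in rho].

Definition Aut_rel (rho : {set k.-tuple 'I_n}) : {set 'S_n} :=
  [set p : 'S_n | preserves p rho].

End Relations.

Arguments rel_down l {n k} rho.
Arguments rel_up {l} n {k} sigma.
Arguments pc_relation l {n k} rho.

(* Relations on [n] of arity at most l, paired with their arity; positivity of
   the arity is imposed in [pcInv]. *)
Definition relation_le l n := {k : 'I_l.+1 & {set k.-tuple 'I_n}}.

Definition Aut_rels l n (R : {set relation_le l n}) : {set 'S_n} :=
  \bigcap_(rho in R) Aut_rel (tagged rho).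

Definition pcInv l n (H : {set 'S_n}) : {set relation_le l n} :=
  [set rho : relation_le l n | [&& 0 < tag rho, pc_relation l (tagged rho)
                  & [forall p in H, preserves p (tagged rho)]]].
Arguments pcInv l {n} H.

(* Main.v *)
(* Every k-tuple over [n] with k <= l factors as h_I(s), and
   p(h_I(s)) = h_{p(I)}(p_I(s)). Hence a permutation whose patterns all lie in
   gPat H preserves every pc-relation that H preserves. Conversely, for a
   group G <= S_l regarded as a set of l-tuples, the single pc-relation
   G^/\ = {h_I(g) | g in G, I} has automorphism set exactly gComp G, because
   the image of h_I(g) is I, so that h_I(g) determines both I and g. *)

Require Import Defs.
From mathcomp Require Import all_boot all_fingroup.

Set Implicit Arguments.
Unset Strict Implicit.
Unset Printing Implicit Defensive.

Section PatternTuples.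
Variables l n : nat.

(** Parametrising tuples over [I] by tuples over ['I_l] avoids the dependent type [elt I]; the
    notions on relations are restated in this form below. *)
Definition h_tuple k (I : lsubset l n) (s : k.-tuple 'I_l) : k.-tuple 'I_n :=
  map_tuple (fun i => val (h I i)) s.

(** The one-line notation of [g]. *)
Definition perm_tuple (g : 'S_l) : l.-tuple 'I_l := [tuple g i | i < l].

Lemma map_h_tuple k (p : 'S_n) (I : lsubset l n) (s : k.-tuple 'I_l) :
  map_tuple p (h_tuple I s)
  = h_tuple (imlsubset p I) (map_tuple (patt p I) s).
Proof.
by apply: eq_from_tnth => i; rewrite !tnth_map h_patt.
Qed.

Lemma h_val_inj (I : lsubset l n) : injective (fun i => val (h I i)).
Proof. by move=> i j /val_inj/(can_inj (@hK _ _ I)). Qed.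

Lemma h_hinv_tuple k (I : lsubset l n) (r : k.-tuple (elt I)) :
  h_tuple I (map_tuple (@hinv l n I) r) = map_tuple val r.
Proof.
by apply: eq_from_tnth => i; rewrite !tnth_map hinvK.
Qed.

(** The entries of [r] form a set of size at most [k <= l], which extends to an [l]-subset [I]
    because [l <= n]; then [s] is the preimage of [r] under [h I]. *)
Lemma h_tuple_surj k (r : k.-tuple 'I_n) :
  k <= l <= n -> exists I : lsubset l n, exists s, r = h_tuple I s.
Proof.
case/andP=> le_kl le_ln.
have le_rl : #|[set x in r]| <= l.
  by rewrite cardsE (leq_trans (card_size r)) ?size_tuple.
have [I rI cardI] : exists2 I : {set 'I_n}, [set x in r] \subset I & #|I| == l.
  have : exists m, #|[set x in r]| + m = l.
    by exists (l - #|[set x in r]|); rewrite subnKC.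
  (* Induction on the number [m] of elements still to be added, the target size varying with it. A
     set of size below [n] always misses some [x]. *)
  case=> m; elim: m l le_ln {le_kl le_rl} => [|m IHm] l' le_l'n.
    by rewrite addn0 => <-; exists [set x in r].
  move=> l'E; move: le_l'n; rewrite -l'E addnS => lt_n.
  have [I rI /eqP cardI] := IHm _ (ltnW lt_n) erefl.
  have /subsetPn[x _ xI] : ~~ ([set: 'I_n] \subset I).
    apply: contraL lt_n => /subset_leq_card.
    by rewrite cardsT card_ord cardI -leqNgt.
  exists (x |: I); first exact: subset_trans rI (subsetUr _ _).
  by rewrite cardsU1 xI cardI.
have tI i : tnth r i \in I by apply: (subsetP rI); rewrite inE mem_tnth.
exists (exist _ I cardI).
exists [tuple @hinv l n (exist _ I cardI) (exist _ (tnth r i) (tI i)) | i < k].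
by apply: eq_from_tnth => i; rewrite tnth_map tnth_mktuple hinvK.
Qed.

Lemma pc_relationP k (rho : {set k.-tuple 'I_n}) :
  reflect (forall I J s, h_tuple I s \in rho -> h_tuple J s \in rho)
          (pc_relation l rho).
Proof.
apply: (iffP idP) => [pc I J s sI | pc].
  have /implyP := forallP (forallP (forallP pc I) J) (map_tuple (h I) s).
  have -> : map_tuple val (map_tuple (h I) s) = h_tuple I s.
    by apply: eq_from_tnth => i; rewrite !tnth_map.
  move/(_ sI); congr (is_true (_ \in rho)).
  by apply: eq_from_tnth => i; rewrite !tnth_map hK.
apply/forallP=> I; apply/forallP=> J; apply/forallP=> r; apply/implyP.
rewrite -h_hinv_tuple => /(pc I J); congr (is_true (_ \in rho)).
by apply: eq_from_tnth => i; rewrite !tnth_map.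
Qed.

Lemma rel_downP k (rho : {set k.-tuple 'I_n}) s :
  reflect (exists I, h_tuple I s \in rho) (s \in rel_down l rho).
Proof.
apply: (iffP bigcupP) => [[I _ /imsetP[r]] | [I sI]].
  by rewrite inE => r_rho ->; exists I; rewrite h_hinv_tuple.
exists I => //; apply/imsetP; exists (map_tuple (h I) s).
  rewrite inE; move: sI; congr (is_true (_ \in rho)).
  by apply: eq_from_tnth => i; rewrite !tnth_map.
by apply: eq_from_tnth => i; rewrite !tnth_map hK.
Qed.

Lemma rel_upP k (sigma : {set k.-tuple 'I_l}) r :
  reflect (exists I, exists2 s, s \in sigma & r = h_tuple I s)
          (r \in rel_up n sigma).
Proof.
apply: (iffP imset2P) => [[s I ss _ ->] | [I [s ss ->]]]; first by exists I, s.
by exists s I; rewrite ?inE.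
Qed.

Lemma rel_up_down_pc k (rho : {set k.-tuple 'I_n}) :
  rho = rel_up n (rel_down l rho) -> pc_relation l rho.
Proof.
move=> rhoE; apply/pc_relationP => I J s sI; rewrite rhoE.
by apply/rel_upP; exists J, s => //; apply/rel_downP; exists I.
Qed.

(** The bounds on [k] and [l] ensure that each tuple of [rho] lies over some [l]-subset, so that
    [rel_down] loses none of them. *)
Lemma pc_rel_up_down k (rho : {set k.-tuple 'I_n}) :
  k <= l <= n -> pc_relation l rho -> rho = rel_up n (rel_down l rho).
Proof.
move=> le_kln /pc_relationP pc; apply/setP=> r.
apply/idP/rel_upP => [r_rho | [J [s /rel_downP[I sI] ->]]]; last exact: pc sI.
have [I [s rE]] := h_tuple_surj r le_kln.
by exists I, s => //; apply/rel_downP; exists I; rewrite -rE.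
Qed.

(** The permutations [g] with the stated property form a group [A], so it suffices to treat the
    generators of [gPat l H], the patterns of members of [H]. *)
Lemma gPat_preserves (H : {set 'S_n}) k (rho : {set k.-tuple 'I_n}) :
    pc_relation l rho -> {in H, forall p, preserves p rho} ->
  {in gPat l H, forall (g : 'S_l) I s,
     h_tuple I s \in rho -> h_tuple I (map_tuple g s) \in rho}.
Proof.
move=> /pc_relationP pc presH.
pose A := [set g : 'S_l | [forall I : lsubset l n, forall s : k.-tuple 'I_l,
  (h_tuple I s \in rho) ==> (h_tuple I (map_tuple g s) \in rho)]].
have inA (g : 'S_l) : reflect (forall I s, h_tuple I s \in rho ->
                        h_tuple I (map_tuple g s) \in rho) (g \in A).
  rewrite inE; apply: (iffP idP) => [gA I s|gA].
    by apply/implyP; have /forallP/(_ s) := forallP gA I.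
  by apply/forallP=> I; apply/forallP=> s; apply/implyP/gA.
have gA : group_set A.
  apply/group_setP; split=> [|g g' /inA Ag /inA Ag'].
    apply/inA=> I s; congr (is_true (h_tuple I _ \in rho)).
    by apply: eq_from_tnth => i; rewrite tnth_map perm1.
  apply/inA=> I s /Ag/Ag'; congr (is_true (h_tuple I _ \in rho)).
  by apply: eq_from_tnth => i; rewrite !tnth_map permM.
have /subsetP sub : gPat l H \subset Group gA.
  rewrite gen_subG; apply/bigcupsP=> p Hp; apply/subsetP=> _ /imsetP[I _ ->].
  (* Pattern closure moves the tuple from [J] to [I], where [p] acts through its pattern at [I]; it
     then moves the image from [p @: I] back to [J]. *)
  apply/inA=> J s /(pc J I)/(forall_inP (presH p Hp)).
  by rewrite map_h_tuple; apply: pc.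
by move=> g /sub/inA.
Qed.

Lemma gComp_gPat_preserves (H : {set 'S_n}) k (rho : {set k.-tuple 'I_n}) :
    k <= l <= n -> pc_relation l rho -> {in H, forall p, preserves p rho} ->
  gComp n (gPat l H) \subset Aut_rel rho.
Proof.
move=> le_kln pc presH; apply/subsetP=> t; rewrite !inE => /subsetP tG.
apply/forall_inP=> r; have [I [s ->]] := h_tuple_surj r le_kln.
rewrite map_h_tuple => sI; apply: (gPat_preserves pc presH).
  exact/tG/imset_f.
exact: (pc_relationP _ pc) sI.
Qed.

Lemma sub_gComp_gPat (H : {set 'S_n}) : H \subset gComp n (gPat l H).
Proof.
apply/subsetP=> p Hp; rewrite inE.
exact: subset_trans (bigcup_sup p Hp) (subset_gen _).
Qed.

Definition group_rel (G : {set 'S_l}) : {set l.-tuple 'I_n} :=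
  rel_up n (perm_tuple @: G).

Lemma group_relP (G : {set 'S_l}) r :
  reflect (exists I, exists2 g, g \in G & r = h_tuple I (perm_tuple g))
          (r \in group_rel G).
Proof.
apply: (iffP (rel_upP _ _)) => [[I [_ /imsetP[g Gg ->] ->]] | [I [g Gg ->]]].
  by exists I, g.
by exists I, (perm_tuple g); rewrite ?imset_f.
Qed.

Lemma uniq_h_perm_tuple I g : uniq (h_tuple I (perm_tuple g)).
Proof.
rewrite map_inj_uniq; last exact: h_val_inj.
by rewrite map_inj_uniq ?enum_uniq //; apply: perm_inj.
Qed.

(** Products of permutations act from left to right, so [g * f] is [g] followed by [f]. *)
Lemma map_perm_tuple (f g : 'S_l) :
  map_tuple f (perm_tuple g) = perm_tuple (g * f)%g.
Proof.
by apply: eq_from_tnth => i; rewrite !tnth_map permM.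
Qed.

(** The entries on the right exhaust [J], those on the left lie in [I], and both sets have [l]
    elements. The tuple [s] is arbitrary so that [group_rel_pc] can infer that it comes from a
    permutation. *)
Lemma h_perm_tuple_inj (I J : lsubset l n) s g :
  h_tuple I s = h_tuple J (perm_tuple g) -> I = J.
Proof.
move=> eq_h; apply/val_inj/esym/eqP.
rewrite eqEcard !card_lsubset leqnn andbT; apply/subsetP=> x Jx.
have /mapP[i _ ->] : x \in h_tuple I s; last exact: valP (h I i).
rewrite eq_h; apply/mapP; pose i := @hinv _ _ J (exist _ x Jx).
exists i; last by rewrite hinvK.
by rewrite -(permKV g i); apply: map_f; rewrite mem_enum.
Qed.

Lemma h_tuple_inj k (I : lsubset l n) : injective (@h_tuple k I).
Proof. by move=> s s' /(congr1 val)/(inj_map (@h_val_inj I))/val_inj. Qed.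

Lemma perm_tuple_inj : injective perm_tuple.
Proof.
move=> g g' eq_g; apply/permP=> i.
by have /(congr1 (fun t => tnth t i)) := eq_g; rewrite !tnth_mktuple.
Qed.

Lemma group_rel_pc (G : {set 'S_l}) : pc_relation l (group_rel G).
Proof.
apply/pc_relationP=> I J s /group_relP[K [g Gg eq_h]].
have eqIK := h_perm_tuple_inj eq_h; subst K.
by rewrite (h_tuple_inj eq_h); apply/group_relP; exists J, g.
Qed.

Lemma Aut_group_rel (G : {group 'S_l}) : Aut_rel (group_rel G) = gComp n G.
Proof.
apply/setP=> t; rewrite !inE; apply/forall_inP/subsetP.
  move=> tG _ /imsetP[I _ ->].
  (* The increasing listing of [I] is a test tuple: its image under [t] is the pattern of [t] at
     [I], written over [t @: I]. *)
  have /tG : h_tuple I (perm_tuple 1) \in group_rel G.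
    by apply/group_relP; exists I, 1%g.
  rewrite map_h_tuple map_perm_tuple mul1g => /group_relP[J [g Gg eq_h]].
  have eqIJ := h_perm_tuple_inj eq_h; subst J.
  by rewrite (perm_tuple_inj (h_tuple_inj eq_h)).
move=> tG _ /group_relP[I [g Gg ->]]; rewrite map_h_tuple map_perm_tuple.
apply/group_relP; exists (imlsubset t I), (g * patt t I)%g => //.
exact/groupM/tG/imset_f.
Qed.

Lemma pcInv_Aut_sub (H : {set 'S_n}) k (rho : {set k.-tuple 'I_n}) :
    0 < k <= l -> pc_relation l rho -> {in H, forall p, preserves p rho} ->
  Aut_rels (pcInv l H) \subset Aut_rel rho.
Proof.
case/andP=> k_gt0 le_kl pc presH.
(* [k <= l] and [k < l.+1] are convertible, so [le_kl] bounds the ordinal. *)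
pose R : relation_le l n := existT _ (Ordinal (le_kl : k < l.+1)) rho.
apply: (bigcap_inf R); rewrite inE k_gt0 pc.
exact/forall_inP.
Qed.

(** For the inclusion from right to left, the single relation [group_rel n (gPat l H)] suffices: it
    belongs to [pcInv l H] because its automorphism set [gComp n (gPat l H)] contains [H]. *)
Lemma gComp_gPatE (H : {set 'S_n}) :
  0 < l <= n -> gComp n (gPat l H) = Aut_rels (pcInv l H).
Proof.
case/andP=> l_gt0 le_ln; apply/eqP; rewrite eqEsubset; apply/andP; split.
  apply/bigcapsP=> -[k rho]; rewrite inE => /and3P[_ pc /forall_inP presH].
  by apply: gComp_gPat_preserves => //; rewrite -ltnS ltn_ord.
rewrite -(Aut_group_rel [group of gPat l H]); apply: pcInv_Aut_sub.
- by rewrite l_gt0 /=.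
- exact: group_rel_pc.
move=> p /(subsetP (sub_gComp_gPat H)).
by rewrite -(Aut_group_rel [group of gPat l H]) inE.
Qed.

End PatternTuples.

Theorem theorem5p3 (l n : nat) (l_gt0 : 0 < l) (n_gt0 : 0 < n) (le_ln : l <= n) :
  (forall H : {group 'S_n},
     gComp n (gPat l H) = Aut_rels (pcInv l H))
  /\
  (forall H : {group 'S_n},
     [<-> (H : {set 'S_n}) = gComp n (gPat l H);
          exists G : {group 'S_l}, (H : {set 'S_n}) = gComp n G;
          (H : {set 'S_n}) = Aut_rels (pcInv l H);
          exists k : nat, exists rho : {set k.-tuple 'I_n},
            [/\ 0 < k <= l,
                rho \subset [set r : k.-tuple 'I_n | uniq r],
                rho = rel_up n (rel_down l rho)
              & (H : {set 'S_n}) = Aut_rel rho]]).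
Proof.
have lnP : 0 < l <= n by rewrite l_gt0.
split=> H; first exact: gComp_gPatE.
tfae.
- by move=> HE; exists [group of gPat l H].
- case=> G HE; rewrite -gComp_gPatE //; apply/eqP.
  rewrite eqEsubset sub_gComp_gPat {2}HE; apply/subsetP=> t; rewrite !inE.
  (* All patterns of members of [H = gComp n G] lie in the group [G], hence so does [gPat l H]. *)
  move/subset_trans; apply; rewrite gen_subG; apply/bigcupsP=> p.
  by rewrite HE inE.
- rewrite -gComp_gPatE // -(Aut_group_rel _ [group of gPat l H]) => HE.
  (* By (A) and [Aut_group_rel], this one [l]-ary relation already has automorphism set [H]. *)
  exists l, (group_rel n (gPat l H)); split=> //; first by rewrite l_gt0 /=.
    apply/subsetP=> _ /group_relP[I [g _ ->]].
    by rewrite inE uniq_h_perm_tuple.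
  by apply: pc_rel_up_down; rewrite ?leqnn //; apply: group_rel_pc.
case=> k [rho [lekl _ rhoE HE]]; rewrite gComp_gPatE //.
(* What remains is that [Aut_rels (pcInv l H)] lies in [Aut_rel rho = H], which holds since [rho] is
   itself a pc-relation preserved by [H]. *)
apply/eqP; rewrite eqEsubset -{1}gComp_gPatE // sub_gComp_gPat /= {2}HE.
apply: pcInv_Aut_sub => //; first exact: rel_up_down_pc.
by move=> p; rewrite HE inE.
Qed.
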